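(* Let $n,d$ be positive integers and let $f$ be a form (homogeneous polynomial) of degree $d$ in $n$ real variables. (i) If $d$ is even, let $\lambda=(\lambda_\alpha)_{\alpha\in\mathcal I_{n,d}}$ be the unique solution of $\widehat V(n,d)^\top\lambda=c$, where $c$ is the coefficient vector of $f$. Then a power-sum-DC decomposition of $f$ is $$f(x)=\sum_{\alpha\in\mathcal I^+}\lambda_\alpha\langle\alpha,x\rangle^d-\sum_{\alpha\in\mathcal I^-}(-\lambda_\alpha)\langle\alpha,x\rangle^d\qquad (x\in\mathbb R^n),$$ where $\mathcal I^+=\{\alpha\in\mathcal I_{n,d}:\lambda_\alpha>0\}$ and $\mathcal I^-=\{\alpha\in\mathcal I_{n,d}:\lambda_\alpha<0\}$. (ii) If $d$ is odd, let $\lambda=(\lambda_\alpha)_{\alpha\in\mathcal I_{n+1,d+1}}$ be the unique solution of $\widehat V(n+1,d+1)^\top\lambda=c$, where $c$ is the coefficient vector of the form $\tilde f(x,x_h)=x_hf(x)$ of degree $d+1$ in $n+1$ variables. Then a power-sum-DC decomposition of $f$ is $$f(x)=\sum_{\alpha\in\mathcal I^+}\lambda_\alpha\langle\alpha,\hat x\rangle^{d+1}-\sum_{\alpha\in\mathcal I^-}(-\lambda_\alpha)\langle\alpha,\hat x\rangle^{d+1}\qquad (x\in\mathbb R^n),$$ where $\mathcal I^+=\{\alpha\in\mathcal I_{n+1,d+1}:\lambda_\alpha>0\}$, $\mathcal I^-=\{\alpha\in\mathcal I_{n+1,d+1}:\lambda_\alpha<0\}$ and $\hat x=\begin{pmatrix}x\\1\end{pmatrix}\in\mathbb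 R^{n+1}$.
   Context: For positive integers $n,d$: $\mathcal I_{n,d}=\{\alpha\in\mathbb N^n:\sum_{i=1}^n\alpha_i=d\}$ with $\mathbb N=\{0,1,\ldots\}$, of cardinality $s_{n,d}=\binom{n+d-1}{d}$, enumerated in a fixed order as $\alpha^1,\ldots,\alpha^{s_{n,d}}$. The coefficient vector of a form $\sum_{\alpha\in\mathcal I_{n,d}}c_\alpha x^\alpha$ is $c=(c_{\alpha^1},\ldots,c_{\alpha^{s_{n,d}}})^\top$. The power-product matrix is $\widehat V(n,d)=\big(\binom{d}{\alpha^j}(\alpha^i)^{\alpha^j}\big)_{1\le i,j\le s_{n,d}}$ with $\binom{d}{\alpha^j}=\frac{d!}{\alpha^j_1!\cdots\alpha^j_n!}$ and $(\alpha^i)^{\alpha^j}=\prod_{k=1}^n(\alpha^i_k)^{\alpha^j_k}$, $0^0=1$; it is known to be nonsingular for all positive integers $n,d$. A power-sum-DC (PSDC) decomposition of a polynomial is an expression of it as a difference $g-h$ of two convex polynomials, each of which is a nonnegative linear combination of even powers of linear forms (in $x$, or in $\hat x$, i.e. affine functions of $x$). *)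

(* Defs.v *)
From mathcomp Require Import all_boot all_order all_algebra.
From mathcomp Require Import mpoly.
From mathcomp Require Import classical_sets reals interval_inference convex.

Set Implicit Arguments.
Unset Strict Implicit.
Unset Printing Implicit Defensive.

Import Order.TTheory GRing.Theory Num.Theory.
Local Open Scope ring_scope.

Definition nmonom (n d : nat) : nat := 'C(n + d - 1, d).

(* [e] lists each exponent of total degree [d] in [n] variables exactly once.
   The ordering is left arbitrary. *)
Definition monom_enum (n d : nat) (e : 'I_(nmonom n d) -> 'X_{1..n}) : Prop :=
  injective e /\ forall a : 'X_{1..n}, mdeg a = d <-> exists i, e i = a.

(* d! / (a_1! ... a_n!), meant for mdeg a = d. *)
Definition multinomial (R : fieldType) (n d : nat) (a : 'X_{1..n}) : R :=
  (d`!)%:R / \prod_(k < n) ((a k)`!)%:R.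

Definition power_product_mx (R : fieldType) (n d s : nat)
    (e : 'I_s -> 'X_{1..n}) : 'M[R]_s :=
  \matrix_(i, j)
    (multinomial R d (e j) * \prod_(k < n) (e i k)%:R ^+ (e j k)).

Definition coef_vec (R : nzRingType) (n s : nat) (e : 'I_s -> 'X_{1..n})
    (p : {mpoly R[n]}) : 'cV[R]_s :=
  \col_i p@_(e i).

Definition peval (R : nzRingType) (n : nat) (p : {mpoly R[n]})
    (x : 'cV[R]_n) : R :=
  p.@[fun k => x k 0].

(* <a, y>; the entries of y are scalars or polynomials. *)
Definition dotm (T : nzRingType) (m : nat) (a : 'X_{1..m}) (y : 'cV[T]_m) : T :=
  \sum_(k < m) (a k)%:R * y k 0.

Definition varv (R : nzRingType) (n : nat) : 'cV[{mpoly R[n]}]_n :=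
  \col_k 'X_k.

Definition hat (T : nzRingType) (n : nat) (y : 'cV[T]_n) : 'cV[T]_(n + 1) :=
  col_mx y (const_mx 1).

(* x_h * f(x); the additional variable x_h is the last one. *)
Definition times_xh (R : comNzRingType) (n : nat) (f : {mpoly R[n]}) :
    {mpoly R[n + 1]} :=
  'X_(rshift n ord0) * (f \mPo [tuple 'X_(lshift 1 k) | k < n]).

Definition convex_poly (R : realType) (n : nat) (p : {mpoly R[n]}) : Prop :=
  convex_function setT (fun x : 'cV[R]_n => peval p x).

Definition linear_form (R : nzRingType) (n : nat) (l : {mpoly R[n]}) : bool :=
  l \is 1.-homog.

(* Linear forms in hat x are the polynomials in x of degree at most 1. *)
Definition affine_form (R : nzRingType) (n : nat) (l : {mpoly R[n]}) : bool :=
  (msize l <= 2)%N.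

Definition even_power_comb (R : realType) (n : nat)
    (L : {mpoly R[n]} -> bool) (p : {mpoly R[n]}) : Prop :=
  exists (m : nat) (c : 'I_m -> R) (l : 'I_m -> {mpoly R[n]}) (r : 'I_m -> nat),
    (forall i, [/\ 0 <= c i, L (l i), (0 < r i)%N & ~~ odd (r i)]) /\
    p = \sum_(i < m) c i *: l i ^+ r i.

(* The power-sum-DC decomposition f = g - h, with powers of forms from L
   (linear_form, or affine_form). *)
Definition psdc_decomposition (R : realType) (n : nat)
    (L : {mpoly R[n]} -> bool) (f g h : {mpoly R[n]}) : Prop :=
  [/\ f = g - h, convex_poly g, convex_poly h,
      even_power_comb L g & even_power_comb L h].

(* Main.v *)
Require Import Defs.
From mathcomp Require Import all_boot all_order all_algebra.
From mathcomp Require Import mpoly.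
From mathcomp Require Import classical_sets reals interval_inference convex.
From mathcomp Require Import zify ring lra.

Set Implicit Arguments.
Unset Strict Implicit.
Unset Printing Implicit Defensive.

Import Order.TTheory GRing.Theory Num.Theory.
Local Open Scope ring_scope.

(** Three facts carry the result.

    - Coefficients: by the multinomial theorem ([mcoeff_dotm_exp]), the
      coefficient of x^b in <a, x>^d is the (a, b) entry of the power-product
      matrix V.  Hence the form sum_a lam_a <a, x>^d has coefficient vector
      V^T lam, and solving V^T lam = c amounts to writing the form as a
      combination of the powers <a, x>^d ([power_sum_of_solution]).

    - Invertibility: V sends the coefficient vector of a form, each entry
      divided by its multinomial coefficient, to the values of the form at the
      lattice points of the simplex sum_k x_k = d.  For a point a of this
      simplex, the form obtained from prod_k prod_(t < a_k) (x_k - t) by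
      replacing t with (t/d) (x_1 + ... + x_n) takes at each lattice point b of
      the simplex the value prod_k prod_(t < a_k) (b_k - t).  This product
      vanishes as soon as some b_k < a_k, which happens for every b <> a since
      a and b have the same sum, and it is nonzero at b = a.  After scaling,
      these Lagrange forms give the columns of an inverse of V
      ([power_product_mx_unit]).

    - Convexity: an even power of an affine function is convex
      ([even_power_comb_convex]), so grouping the terms of the power sum by the
      sign of lam_a writes it as a difference of two convex power sums
      ([psdc_of_power_sum]).

    For d odd, x_h f is a form of even degree d + 1 to which the first two facts
    apply; substituting x_h = 1 gives f back and turns <a, (x, x_h)> into the
    affine function <a, (x, 1)> ([power_sum_dehomogenize]). *)

(** * Powers of linear forms and their coefficients *)

Lemma dotm_morph (S T : nzRingType) (phi : {rmorphism S -> T}) m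
    (a : 'X_{1..m}) (y : 'cV[S]_m) :
  phi (dotm a y) = dotm a (map_mx phi y).
Proof.
rewrite /dotm rmorph_sum; apply: eq_bigr => k _.
by rewrite rmorphM rmorph_nat mxE.
Qed.

Lemma dhomog_bigprod (R : nzRingType) n (I : Type) (r : seq I)
    (F : I -> {mpoly R[n]}) (g : I -> nat) :
  (forall i, F i \is (g i).-homog) ->
  \prod_(i <- r) F i \is (\sum_(i <- r) g i)%N.-homog.
Proof.
move=> hF; elim/big_rec2: _ => [|i p d _ hp]; first exact: dhomog1.
exact: dhomogM.
Qed.

Lemma dotm_varv (R : nzRingType) n (a : 'X_{1..n}) :
  dotm a (varv R n) = \sum_(k < n) (a k)%:R *: 'X_k.
Proof.
by apply: eq_bigr => k _; rewrite !mxE scaler_nat mulr_natl.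
Qed.

Lemma linear_form_dotm (R : nzRingType) n (a : 'X_{1..n}) :
  linear_form (dotm a (varv R n)).
Proof.
rewrite /linear_form dotm_varv; apply: rpred_sum => k _.
by apply: dhomogZ; rewrite dhomogX /= mdeg1.
Qed.

Lemma mderiv_expS (R : comNzRingType) n (p : {mpoly R[n]}) k d :
  (p ^+ d.+1)^`M(k) = (p^`M(k) * p ^+ d) *+ d.+1.
Proof.
elim: d => [|d IH]; first by rewrite expr1 expr0 mulr1.
by rewrite exprS mderivM IH mulrnAr [in RHS]mulrS mulrCA -exprS.
Qed.

Lemma prod_fact_succ n (m : 'X_{1..n}) k :
  (\prod_(j < n) ((m + U_(k))%MM j)`! = (m k).+1 * \prod_(j < n) (m j)`!)%N.
Proof.
rewrite (bigD1 k) //= [in RHS](bigD1 k) //= mulnA -factS.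
rewrite mnmDE mnm1E eqxx addn1; congr (_ * _)%N.
apply: eq_bigr => j jk.
by rewrite mnmDE mnm1E eq_sym (negbTE jk) addn0.
Qed.

(** Raising one exponent and the degree by one: the recurrence that matches
    differentiation of a power of a linear form. *)
Lemma multinomial_succ (R : numFieldType) n d (m : 'X_{1..n}) k :
  multinomial R d.+1 (m + U_(k))%MM * (m k).+1%:R =
  multinomial R d m * d.+1%:R.
Proof.
rewrite /multinomial -!natr_prod prod_fact_succ factS !natrM.
have h1 : (m k).+1%:R != 0 :> R by rewrite pnatr_eq0.
have h2 : (\prod_(i < n) (m i)`!)%:R != 0 :> R.
  by rewrite pnatr_eq0 -lt0n prodn_gt0 // => i; exact: fact_gt0.
by field; rewrite h2 nat1r h1.
Qed.

(** The multinomial theorem.  By induction on [d]: the derivative of l^(d+1) in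
    a variable X_k is (d + 1) a_k l^d, so comparing coefficients at m - U_k, for
    any k in the support of m, determines the coefficient of l^(d+1) at m from a
    single coefficient of l^d. *)
Lemma mcoeff_dotm_exp (R : numFieldType) n (a m : 'X_{1..n}) d :
  mdeg m = d ->
  (dotm a (varv R n) ^+ d)@_m =
    multinomial R d m * \prod_(k < n) (a k)%:R ^+ m k.
Proof.
elim: d m => [|d IH] m hm.
  have -> : m = 0%MM by apply/eqP; rewrite -mdeg_eq0 hm.
  rewrite expr0 mcoeff1 eqxx /multinomial fact0.
  by rewrite !big1 ?divr1 ?mulr1 // => k _; rewrite mnm0E.
have [k mk] : exists k, m k != 0%N.
  case: (pickP (fun k => m k != 0%N)) => [k ? | m0]; first by exists k.
  by move: hm; rewrite mdegE big1 // => k _; apply/eqP/negbFE/m0.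
pose m' := (m - U_(k))%MM.
have mE : m = (m' + U_(k))%MM.
  rewrite submK //; apply/mnm_lepP => l; rewrite mnm1E.
  by case: eqVneq => // <-; rewrite lt0n.
have hm' : mdeg m' = d by move: hm; rewrite mE mdegD mdeg1 addn1 => -[].
have := congr1 (mcoeff m') (mderiv_expS (dotm a (varv R n)) k d).
have -> : (dotm a (varv R n))^`M(k) = (a k)%:R%:MP.
  rewrite dotm_varv linear_sum (bigD1 k) //= big1 ?addr0 => [|j jk].
    rewrite linearZ /= mderivX mnm1E eqxx scale1r.
    have -> : (U_(k) - U_(k) = 0 :> 'X_{1..n})%MM.
      by apply/mnmP => j; rewrite mnmBE mnm0E subnn.
    by rewrite mpolyX0 -mul_mpolyC mulr1.
  by rewrite linearZ /= mderivX mnm1E (negbTE jk) scale0r scaler0.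
rewrite mcoeff_deriv -mE mcoeffMn mcoeffCM (IH _ hm') => h.
have mk0 : (m' k).+1%:R != 0 :> R by rewrite pnatr_eq0.
apply: (mulIf mk0); rewrite mulr_natr h mE [RHS]mulrAC multinomial_succ.
have powE (b : 'X_{1..n}) :
    \prod_(j < n) (a j)%:R ^+ b j =
    ('X_[b] : {mpoly R[n]}).@[fun j => (a j)%:R].
  by rewrite mevalX.
rewrite !powE mpolyXD rmorphM /= mevalXU -mulr_natr; ring.
Qed.

Lemma multinomial_neq0 (R : numFieldType) n d (m : 'X_{1..n}) :
  multinomial R d m != 0.
Proof.
rewrite /multinomial -natr_prod.
rewrite mulf_neq0 ?invr_eq0 // pnatr_eq0 -lt0n ?fact_gt0 //.
by rewrite prodn_gt0 // => i; exact: fact_gt0.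
Qed.

Lemma dhomog_monom_enumE (R : nzRingType) n d
    (e : 'I_(nmonom n d) -> 'X_{1..n}) (p : {mpoly R[n]}) :
  monom_enum e -> p \is d.-homog -> p = \sum_i p@_(e i) *: 'X_[e i].
Proof.
move=> [einj eonto] hp; apply/mpolyP => m; rewrite raddf_sum /=.
have [hm|hm] := eqVneq (mdeg m) d.
  have [i <-] := (eonto m).1 hm.
  rewrite (bigD1 i) //= big1 ?addr0 => [|j ji].
    by rewrite mcoeffZ mcoeffX eqxx mulr1.
  by rewrite mcoeffZ mcoeffX (inj_eq einj) (negbTE ji) mulr0.
rewrite (dhomog_nemf_coeff hp hm) big1 // => j _.
rewrite mcoeffZ mcoeffX; case: eqP => [hj|]; last by rewrite mulr0.
by case/eqP: hm; apply/(eonto m).2; exists j.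
Qed.

(** * Invertibility of the power-product matrix *)

(** On the hyperplane sum_j x_j = d the linear factors become x_k - t, so this
    is a homogeneous version of the product of falling factorials
    x_k (x_k - 1) ... (x_k - a_k + 1). *)
Definition lagrange (R : numFieldType) n d (a : 'X_{1..n}) : {mpoly R[n]} :=
  \prod_(k < n) \prod_(t < a k) ('X_k - (t%:R / d%:R) *: \sum_(j < n) 'X_j).

Lemma lagrange_dhomog (R : numFieldType) n d (a : 'X_{1..n}) :
  lagrange R d a \is (mdeg a).-homog.
Proof.
rewrite mdegE; apply: dhomog_bigprod => k.
have aE : a k = (\sum_(t < a k) 1)%N by rewrite sum1_card card_ord.
rewrite [X in _ \is X.-homog]aE; apply: dhomog_bigprod => t.
have hX j : ('X_j : {mpoly R[n]}) \is 1.-homog by rewrite dhomogX /= mdeg1.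
by apply: rpredB => //; apply: dhomogZ; apply: rpred_sum.
Qed.

Lemma lagrange_eval (R : numFieldType) n d (a b : 'X_{1..n}) :
  (0 < d)%N -> mdeg b = d ->
  (lagrange R d a).@[fun k => (b k)%:R] =
  \prod_(k < n) \prod_(t < a k) ((b k)%:R - t%:R).
Proof.
move=> d0 hb; rewrite rmorph_prod; apply: eq_bigr => k _ /=.
rewrite rmorph_prod; apply: eq_bigr => t _ /=.
rewrite rmorphB /= mevalXU mevalZ rmorph_sum /=.
under eq_bigr do rewrite mevalXU.
by rewrite -natr_sum -mdegE hb divfK // pnatr_eq0 -lt0n.
Qed.

Lemma lagrange_eval_self (R : numFieldType) n d (a : 'X_{1..n}) :
  (0 < d)%N -> mdeg a = d -> (lagrange R d a).@[fun k => (a k)%:R] != 0.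
Proof.
move=> d0 ha; rewrite lagrange_eval //.
apply/prodf_neq0 => k _; apply/prodf_neq0 => t _.
by rewrite subr_eq0 eqr_nat gtn_eqF.
Qed.

(** Two distinct exponents of the same degree satisfy b_k < a_k for some k; the
    factor with t = b_k then vanishes at b. *)
Lemma lagrange_eval_neq (R : numFieldType) n d (a b : 'X_{1..n}) :
  (0 < d)%N -> mdeg a = d -> mdeg b = d -> b != a ->
  (lagrange R d a).@[fun k => (b k)%:R] = 0.
Proof.
move=> d0 ha hb ba; rewrite lagrange_eval //.
have [k hk] : exists k, (b k < a k)%N.
  case: (pickP (fun k => (b k < a k)%N)) => [k ? | le_ab]; first by exists k.
  have le_a_b : (a <= b)%MM.
    by apply/mnm_lepP => k; rewrite leqNgt le_ab.
  case/eqP: ba; rewrite -(submK le_a_b).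
  suff -> : (b - a = 0)%MM by rewrite add0m.
  apply/eqP; rewrite -mdeg_eq0.
  by have := congr1 mdeg (submK le_a_b); rewrite mdegD ha hb; lia.
rewrite (bigD1 k) //= [X in X * _](bigD1 (Ordinal hk)) //=.
by rewrite subrr !mul0r.
Qed.

(** Column [i] of the right inverse [C] lists the coefficients of the Lagrange
    form of [e i], divided by the multinomial coefficients that V carries and by
    the value of that form at its own point. *)
Lemma power_product_mx_unit (R : numFieldType) n d
    (e : 'I_(nmonom n d) -> 'X_{1..n}) :
  (0 < d)%N -> monom_enum e -> power_product_mx R d e \in unitmx.
Proof.
move=> d0 he; have [einj eonto] := he.
have edeg i : mdeg (e i) = d by apply/(eonto _).2; exists i.
pose L i := lagrange R d (e i).
pose C : 'M[R]_(nmonom n d) := \matrix_(j, i)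
  ((L i)@_(e j) / (multinomial R d (e j) * (L i).@[fun k => (e i k)%:R])).
suff /mulmx1_unit[] : power_product_mx R d e *m C = 1%:M by [].
apply/matrixP => i i'; rewrite !mxE.
have hL : L i' \is d.-homog by rewrite -(edeg i') lagrange_dhomog.
transitivity ((L i').@[fun k => (e i k)%:R] / (L i').@[fun k => (e i' k)%:R]).
  rewrite {1}(dhomog_monom_enumE he hL) rmorph_sum mulr_suml.
  apply: eq_bigr => j _; rewrite !mxE /= mevalZ mevalX.
  have h1 := multinomial_neq0 R d (e j).
  have h2 := lagrange_eval_self R d0 (edeg i').
  by rewrite -/(L i') in h2; field; rewrite h1 h2.
have [->|ii'] := eqVneq i i'; first by rewrite divff // lagrange_eval_self.
by rewrite lagrange_eval_neq ?mul0r // (inj_eq einj).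
Qed.

(** Both sides are forms of degree [d], and the coefficient of the right-hand
    side at [e j] is the [j]-th entry of V^T lam. *)
Lemma power_sum_of_solution (R : numFieldType) n d
    (e : 'I_(nmonom n d) -> 'X_{1..n}) (p : {mpoly R[n]})
    (lam : 'cV[R]_(nmonom n d)) :
  monom_enum e -> p \is d.-homog ->
  (power_product_mx R d e)^T *m lam = coef_vec e p ->
  p = \sum_i lam i 0 *: dotm (e i) (varv R n) ^+ d.
Proof.
move=> he hp hlam; have edeg i : mdeg (e i) = d by apply/(he.2 _).2; exists i.
rewrite (dhomog_monom_enumE he hp) [RHS](dhomog_monom_enumE he); last first.
  apply: rpred_sum => i _; apply: dhomogZ.
  by rewrite -[d in d.-homog]mul1n; apply/dhomogMn/linear_form_dotm.
apply: eq_bigr => j _; congr (_ *: _).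
have /colP/(_ j) := hlam; rewrite !mxE => <-.
rewrite raddf_sum; apply: eq_bigr => i _.
by rewrite /= mcoeffZ mcoeff_dotm_exp // !mxE mulrC.
Qed.

Lemma solution_unique (R : numFieldType) n d
    (e : 'I_(nmonom n d) -> 'X_{1..n}) (c : 'cV[R]_(nmonom n d)) :
  (0 < d)%N -> monom_enum e ->
  unique (fun l => (power_product_mx R d e)^T *m l = c)
    (invmx (power_product_mx R d e)^T *m c).
Proof.
move=> d0 he; have U := power_product_mx_unit R d0 he.
rewrite -unitmx_tr in U.
by split=> [|l <-]; [rewrite mulKVmx | rewrite mulKmx].
Qed.

(** * Convexity of even powers of affine forms *)

Lemma exprn_conv_nonneg (R : realFieldType) (t a b : R) q :
  0 <= t -> t <= 1 -> 0 <= a -> 0 <= b ->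
  (t * a + (1 - t) * b) ^+ q <= t * a ^+ q + (1 - t) * b ^+ q.
Proof.
move=> t0 t1 a0 b0; elim: q => [|q IH]; first by rewrite !expr0; lra.
(* a^q and b^q are ordered like a and b; multiplied by t (1 - t), this product
   is exactly the gap in the induction step. *)
have mono : 0 <= (a - b) * (a ^+ q - b ^+ q).
  have [ab|/ltW ba] := leP a b.
    by rewrite mulr_le0 // subr_le0 // lerXn2r.
  by rewrite mulr_ge0 // subr_ge0 // lerXn2r.
have m0 : 0 <= t * a + (1 - t) * b by nra.
rewrite exprS; apply: le_trans (ler_wpM2l m0 IH) _.
rewrite -subr_ge0 !exprS.
have -> : t * (a * a ^+ q) + (1 - t) * (b * b ^+ q)
    - (t * a + (1 - t) * b) * (t * a ^+ q + (1 - t) * b ^+ q)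
    = t * (1 - t) * ((a - b) * (a ^+ q - b ^+ q)) by ring.
by rewrite mulr_ge0 // mulr_ge0 // subr_ge0.
Qed.

(** An even power is a power of the square: squaring is convex, and the powers
    are increasing and convex on the nonnegative numbers. *)
Lemma exprn_even_conv (R : realFieldType) (t a b : R) r :
  ~~ odd r -> 0 <= t -> t <= 1 ->
  (t * a + (1 - t) * b) ^+ r <= t * a ^+ r + (1 - t) * b ^+ r.
Proof.
move=> re t0 t1; rewrite -(even_halfK re) -mul2n !exprM.
have sq : (t * a + (1 - t) * b) ^+ 2 <= t * a ^+ 2 + (1 - t) * b ^+ 2.
  have -> : (t * a + (1 - t) * b) ^+ 2 =
      t * a ^+ 2 + (1 - t) * b ^+ 2 - t * (1 - t) * (a - b) ^+ 2 by ring.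
  by rewrite gerBl mulr_ge0 ?sqr_ge0 // mulr_ge0 ?subr_ge0.
apply: le_trans (exprn_conv_nonneg r./2 t0 t1 (sqr_ge0 a) (sqr_ge0 b)).
by rewrite lerXn2r // nnegrE ?sqr_ge0 //; apply: le_trans sq; apply: sqr_ge0.
Qed.

(** Only the monomials 1 and X_k occur in an affine form, and each of them
    commutes with affine combinations. *)
Lemma affine_form_eval (R : comNzRingType) n (l : {mpoly R[n]}) (t : R)
    (x y : 'cV[R]_n) :
  affine_form l ->
  peval l (t *: x + (1 - t) *: y) = t * peval l x + (1 - t) * peval l y.
Proof.
move=> hl; rewrite /peval !mevalE !mulr_sumr -big_split.
apply: eq_big_seq => m /msize_mdeg_lt mm /=.
have : (mdeg m <= 1)%N by rewrite -ltnS (leq_trans mm).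
rewrite leq_eqVlt ltnS leqn0 mdeg_eq0 => /orP[/mdeg1P[k /eqP ->]|/eqP ->].
  have E (z : 'I_n -> R) : \prod_(i < n) z i ^+ (U_(k)%MM : 'X_{1..n}) i = z k.
    by rewrite -mevalX mevalXU.
  by rewrite !E !mxE; ring.
have E (z : 'I_n -> R) : \prod_(i < n) z i ^+ (0%MM : 'X_{1..n}) i = 1 :> R.
  by rewrite -mevalX mpolyX0 rmorph1.
by rewrite !E; ring.
Qed.

Lemma even_power_comb_convex (R : realType) n (p : {mpoly R[n]}) :
  even_power_comb (@affine_form R n) p -> convex_poly p.
Proof.
case=> m [c [l [r [H ->]]]] t x y _ _.
have t0 : 0 <= t%:num :> R by [].
have t1 : t%:num <= 1 :> R by [].
set T : R := t%:num in t0 t1 *.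
(* Convex combinations in R^n and in R unfold to this by conversion. *)
change (peval (\sum_(i < m) c i *: l i ^+ r i) (T *: x + (1 - T) *: y) <=
  T * peval (\sum_(i < m) c i *: l i ^+ r i) x +
  (1 - T) * peval (\sum_(i < m) c i *: l i ^+ r i) y).
have E z : peval (\sum_(i < m) c i *: l i ^+ r i) z =
    \sum_(i < m) c i * peval (l i) z ^+ r i.
  rewrite /peval rmorph_sum; apply: eq_bigr => i _.
  by rewrite /= mevalZ rmorphXn.
rewrite !E !mulr_sumr -big_split; apply: ler_sum => i _ /=.
have [c0 hl _ re] := H i.
rewrite affine_form_eval // [T * (_ * _)]mulrCA.
rewrite [(1 - T) * (c i * _)]mulrCA -mulrDr.
exact: ler_wpM2l (exprn_even_conv _ _ re t0 t1).
Qed.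

(** Coefficients outside [P] are set to 0, so that all of 'I_s can serve as
    the index set of the combination. *)
Lemma even_power_comb_sum (R : realType) n s (L : {mpoly R[n]} -> bool)
    (P : pred 'I_s) (c : 'I_s -> R) (l : 'I_s -> {mpoly R[n]}) r :
  (0 < r)%N -> ~~ odd r -> (forall i, L (l i)) ->
  (forall i, P i -> 0 <= c i) ->
  even_power_comb L (\sum_(i | P i) c i *: l i ^+ r).
Proof.
move=> r0 re hL hc.
exists s, (fun i => if P i then c i else 0), l, (fun=> r); split.
  by move=> i; split=> //; case: ifP => // /hc.
rewrite big_mkcond; apply: eq_bigr => i _.
by case: ifP => // _; rewrite scale0r.
Qed.

Lemma sub_even_power_comb (R : realType) n (L L' : {mpoly R[n]} -> bool) p :
  (forall l, L l -> L' l) -> even_power_comb L p -> even_power_comb L' p.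
Proof.
move=> LL' [m [c [l [r [H ->]]]]]; exists m, c, l, r; split=> // i.
by have [? /LL' ? ? ?] := H i; split.
Qed.

(** * Power sums as differences of convex polynomials *)

Lemma linear_form_affine (R : nzRingType) n (l : {mpoly R[n]}) :
  linear_form l -> affine_form l.
Proof.
move=> /dhomogP hl; rewrite /affine_form msizeE.
by apply/bigmax_leqP_seq => m /hl /= ->.
Qed.

Lemma affine_form_dotm_hat (R : nzRingType) n (a : 'X_{1..n + 1}) :
  affine_form (dotm a (hat (varv R n))).
Proof.
rewrite /dotm /affine_form.
elim/big_ind: _ => [|p q hp hq|k _]; first by rewrite msize0.
  by rewrite (leq_trans (msizeD_le _ _)) // geq_max hp.
rewrite mulr_natl -scaler_nat (leq_trans (msizeZ_le _ _)) //.
rewrite mxE; case: splitP => j _; rewrite !mxE; last by rewrite msize1.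
by rewrite msizeX mdeg1.
Qed.

Lemma big_sign_split (R : realDomainType) (V : lmodType R) s (c : 'I_s -> R)
    (v : 'I_s -> V) :
  \sum_i c i *: v i =
  \sum_(i | 0 < c i) c i *: v i - \sum_(i | c i < 0) - c i *: v i.
Proof.
rewrite -sumrN; under [X in _ = _ + X]eq_bigr do rewrite scaleNr opprK.
rewrite [in RHS]big_mkcond [X in _ = _ + X]big_mkcond -big_split.
apply: eq_bigr => i _ /=.
by case: (ltgtP (c i) 0) => [||->]; rewrite ?addr0 ?add0r ?scale0r.
Qed.

(** Both parts are nonnegative combinations of even powers of affine forms, and
    this shape alone makes them convex. *)
Lemma psdc_of_power_sum (R : realType) n s (L : {mpoly R[n]} -> bool) f
    (c : 'I_s -> R) (l : 'I_s -> {mpoly R[n]}) r :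
  (forall p, L p -> affine_form p) -> (forall i, L (l i)) ->
  (0 < r)%N -> ~~ odd r -> f = \sum_i c i *: l i ^+ r ->
  psdc_decomposition L f (\sum_(i | 0 < c i) c i *: l i ^+ r)
    (\sum_(i | c i < 0) - c i *: l i ^+ r).
Proof.
move=> Laff hL r0 re ->.
have G : even_power_comb L (\sum_(i | 0 < c i) c i *: l i ^+ r).
  by apply: even_power_comb_sum => // i /ltW.
have H : even_power_comb L (\sum_(i | c i < 0) - c i *: l i ^+ r).
  by apply: even_power_comb_sum => // i; rewrite oppr_ge0 => /ltW.
split=> //; first exact: big_sign_split.
  exact/even_power_comb_convex/(sub_even_power_comb Laff).
exact/even_power_comb_convex/(sub_even_power_comb Laff).
Qed.

Lemma peval_power_sum (R : realFieldType) n s m (c : 'I_s -> R)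
    (e : 'I_s -> 'X_{1..m}) (y : 'cV[{mpoly R[n]}]_m) r (x : 'cV[R]_n) :
  let z := map_mx (fun p => peval p x) y in
  peval (\sum_i c i *: dotm (e i) y ^+ r) x =
    \sum_(i | 0 < c i) c i * dotm (e i) z ^+ r
    - \sum_(i | c i < 0) - c i * dotm (e i) z ^+ r.
Proof.
move=> z; rewrite /peval rmorph_sum /=.
under eq_bigr do rewrite mevalZ rmorphXn /= dotm_morph.
exact: (big_sign_split c (fun i => dotm (e i) z ^+ r : R^o)).
Qed.

Lemma map_peval_varv (R : nzRingType) n (x : 'cV[R]_n) :
  map_mx (fun p => peval p x) (varv R n) = x.
Proof. by apply/colP => k; rewrite !mxE /peval mevalXU. Qed.

Lemma map_peval_hat (R : nzRingType) n (x : 'cV[R]_n) :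
  map_mx (fun p => peval p x) (hat (varv R n)) = hat x.
Proof.
rewrite /hat map_col_mx map_peval_varv; congr col_mx.
by apply/colP => k; rewrite !mxE /peval -mpolyC1 mevalC.
Qed.

(** * Homogenization and dehomogenization *)

Lemma times_xh_dhomog (R : comNzRingType) n d (f : {mpoly R[n]}) :
  f \is d.-homog -> times_xh f \is (d + 1).-homog.
Proof.
move=> /dhomogP hf; have dX k : ('X_k : {mpoly R[n + 1]}) \is 1.-homog.
  by rewrite dhomogX /= mdeg1.
rewrite (addnC d); apply: dhomogM => //; rewrite comp_mpolyEX.
rewrite big_seq; apply: rpred_sum => m /hf /= <-; apply: dhomogZ.
rewrite comp_mpolyX mdegE; apply: dhomog_bigprod => k.
by rewrite tnth_mktuple -[X in _ \is X.-homog]mul1n; apply: dhomogMn.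
Qed.

(** The substitution x_h = 1. *)
Lemma times_xh_dehomogenize (R : comNzRingType) n (f : {mpoly R[n]}) :
  times_xh f \mPo [tuple hat (varv R n) k 0 | k < n + 1] = f.
Proof.
rewrite /times_xh rmorphM /= comp_mpolyXU -tnth_nth tnth_mktuple.
rewrite /hat col_mxEd mxE mul1r [in RHS](mpolyE f) (comp_mpolyEX f).
rewrite [LHS]rmorph_sum.
apply: eq_bigr => m _ /=; rewrite comp_mpolyZ; congr (_ *: _).
rewrite comp_mpolyX rmorph_prod [RHS]mpolyXE_id; apply: eq_bigr => k _.
rewrite rmorphXn /= tnth_mktuple comp_mpolyXU -tnth_nth tnth_mktuple.
by rewrite col_mxEu mxE.
Qed.

Lemma power_sum_dehomogenize (R : comNzRingType) n s
    (e : 'I_s -> 'X_{1..n + 1}) (c : 'I_s -> R) r (f : {mpoly R[n]}) :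
  times_xh f = \sum_i c i *: dotm (e i) (varv R (n + 1)) ^+ r ->
  f = \sum_i c i *: dotm (e i) (hat (varv R n)) ^+ r.
Proof.
move=> hf; rewrite -[LHS]times_xh_dehomogenize hf rmorph_sum.
apply: eq_bigr => i _; rewrite /= comp_mpolyZ rmorphXn /= dotm_morph.
suff -> : map_mx (comp_mpoly [tuple hat (varv R n) k 0 | k < n + 1])
    (varv R (n + 1)) = hat (varv R n) by [].
by apply/colP => k; rewrite !mxE comp_mpolyXU -tnth_nth tnth_mktuple mxE.
Qed.

(** * The power-sum-DC decomposition *)

Theorem proposition1 (R : realType) (n d : nat) (f : {mpoly R[n]}) :
  (0 < n)%N -> (0 < d)%N -> f \is d.-homog ->
  (~~ odd d ->
   forall e : 'I_(nmonom n d) -> 'X_{1..n}, monom_enum e ->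
   exists lam : 'cV[R]_(nmonom n d),
     unique (fun l => (power_product_mx R d e)^T *m l = coef_vec e f) lam /\
     psdc_decomposition (@linear_form R n) f
       (\sum_(i | 0 < lam i 0) lam i 0 *: dotm (e i) (varv R n) ^+ d)
       (\sum_(i | lam i 0 < 0) - lam i 0 *: dotm (e i) (varv R n) ^+ d) /\
     (forall x : 'cV[R]_n,
        peval f x = \sum_(i | 0 < lam i 0) lam i 0 * dotm (e i) x ^+ d
                  - \sum_(i | lam i 0 < 0) - lam i 0 * dotm (e i) x ^+ d)) /\
  (odd d ->
   forall e : 'I_(nmonom (n + 1) (d + 1)) -> 'X_{1..(n + 1)}, monom_enum e ->
   exists lam : 'cV[R]_(nmonom (n + 1) (d + 1)),
     unique (fun l => (power_product_mx R (d + 1) e)^T *m l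
                      = coef_vec e (times_xh f)) lam /\
     psdc_decomposition (@affine_form R n) f
       (\sum_(i | 0 < lam i 0)
          lam i 0 *: dotm (e i) (hat (varv R n)) ^+ (d + 1))
       (\sum_(i | lam i 0 < 0)
          - lam i 0 *: dotm (e i) (hat (varv R n)) ^+ (d + 1)) /\
     (forall x : 'cV[R]_n,
        peval f x
        = \sum_(i | 0 < lam i 0) lam i 0 * dotm (e i) (hat x) ^+ (d + 1)
        - \sum_(i | lam i 0 < 0) - lam i 0 * dotm (e i) (hat x) ^+ (d + 1))).
Proof.
move=> n0 d0 hf; split=> [de|dodd] e he.
  exists (invmx (power_product_mx R d e)^T *m coef_vec e f).
  have U := solution_unique (coef_vec e f) d0 he.
  set lam := (X in unique _ X) in U *.
  have fE := power_sum_of_solution he hf U.1.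
  split=> //; split=> [|x].
    apply: psdc_of_power_sum => // [p|i]; first exact: linear_form_affine.
    exact: linear_form_dotm.
  by rewrite {1}fE peval_power_sum map_peval_varv.
have d1 : (0 < d + 1)%N by rewrite addn1.
exists (invmx (power_product_mx R (d + 1) e)^T *m coef_vec e (times_xh f)).
have U := solution_unique (coef_vec e (times_xh f)) d1 he.
set lam := (X in unique _ X) in U *.
have hF := times_xh_dhomog hf.
have fE := power_sum_dehomogenize (power_sum_of_solution he hF U.1).
split=> //; split=> [|x].
  apply: psdc_of_power_sum => // [i|]; first exact: affine_form_dotm_hat.
  by rewrite addn1 /= dodd.
by rewrite {1}fE peval_power_sum map_peval_hat.
Qed.
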